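(* Let $R=\cos\alpha\,I+\sin\alpha\,J$ be an equiangular rotation of $\mathbb{R}^4$ with rotation angle $\alpha$, where $J=\mathbf{b}\mathbf{a}^T-\mathbf{a}\mathbf{b}^T+\mathbf{d}\mathbf{c}^T-\mathbf{c}\mathbf{d}^T$. Then a subspace $U$ of $\mathbb{R}^4$ is an invariant subspace of $R$ if and only if it is an invariant subspace of $J$. The matrix $J$ is skew-symmetric with $J^2=-I$, so it has no real eigenvalues, and any non-trivial invariant subspace has dimension two. For any $\mathbf{u}\in\mathbb{R}^4$, $\operatorname{span}\{\mathbf{u},J\mathbf{u}\}$ is an invariant subspace of $R$; conversely, if $U$ is a non-trivial invariant subspace of $R$, then $J\mathbf{u}\in U$ for any $\mathbf{u}\in U$, and $U$ is spanned by such vectors $\mathbf{u},J\mathbf{u}$. In particular there are infinitely many two-dimensional invariant planes, and this complete classification of the invariant subspaces of equiangular rotations is independent of the rotation angle $\alpha$.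
   Context: Vectors of $\mathbb{R}^4$ are column vectors and $I$ is the $4\times4$ identity matrix. A rotation $R$ of $\mathbb{R}^4$ is called equiangular (or isoclinic) if a plane $\Pi$ and its orthogonal complement $\Pi^\perp$ rotate with the same angle $\alpha$: with $\{\mathbf{a},\mathbf{b},\mathbf{c},\mathbf{d}\}$ an orthonormal basis of $\mathbb{R}^4$ such that $\mathbf{a},\mathbf{b}\in\Pi$ and $\mathbf{c},\mathbf{d}\in\Pi^\perp$, one has $R\mathbf{a}=\cos\alpha\,\mathbf{a}+\sin\alpha\,\mathbf{b}$, $R\mathbf{b}=-\sin\alpha\,\mathbf{a}+\cos\alpha\,\mathbf{b}$, $R\mathbf{c}=\cos\alpha\,\mathbf{c}+\sin\alpha\,\mathbf{d}$, $R\mathbf{d}=-\sin\alpha\,\mathbf{c}+\cos\alpha\,\mathbf{d}$, which is the same as $R=\cos\alpha\,I+\sin\alpha\,J$ with $J=\mathbf{b}\mathbf{a}^T-\mathbf{a}\mathbf{b}^T+\mathbf{d}\mathbf{c}^T-\mathbf{c}\mathbf{d}^T$. A subspace $U$ is an invariant subspace of a matrix $M$ if $M\mathbf{x}\in U$ for all $\mathbf{x}\in U$; it is non-trivial if $U\neq\{\mathbf{0}\}$ and $U\neq\mathbb{R}^4$.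
   Formalization: The equivalence of R- and J-invariance, the converse classification and the independence of the angle are stated for angles with nonzero sine; at sin α = 0 the rotation is I or -I, every line is invariant, and these claims fail. *)

(* Defs.v *)
From HB Require Import structures.
From mathcomp Require Import all_boot all_order all_algebra.
From mathcomp Require Import all_classical all_reals all_analysis.

Set Implicit Arguments.
Unset Strict Implicit.
Unset Printing Implicit Defensive.

Import Order.TTheory GRing.Theory Num.Theory.
Local Open Scope ring_scope.

Definition dot (R : realType) (u v : 'cV[R]_4) : R := (u^T *m v) 0 0.

(* Four orthonormal vectors of a space of dimension 4 form a basis. *)
Definition orthonormal_basis (R : realType) (a b c d : 'cV[R]_4) : Prop :=
  let e := [tuple a; b; c; d] in
  forall i j : 'I_4, dot (tnth e i) (tnth e j) = (i == j)%:R.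

Definition rotation (R : realType) (M : 'M[R]_4) : Prop :=
  M^T *m M = 1%:M /\ \det M = 1.

(* The plane is span {a, b}, its orthogonal complement is span {c, d}. *)
Definition equiangular (R : realType) (alpha : R) (a b c d : 'cV[R]_4)
    (M : 'M[R]_4) : Prop :=
  [/\ rotation M, orthonormal_basis a b c d,
      M *m a = cos alpha *: a + sin alpha *: b /\
      M *m b = - sin alpha *: a + cos alpha *: b
    & M *m c = cos alpha *: c + sin alpha *: d /\
      M *m d = - sin alpha *: c + cos alpha *: d].

Definition Jmx (R : realType) (a b c d : 'cV[R]_4) : 'M[R]_4 :=
  b *m a^T - a *m b^T + d *m c^T - c *m d^T.

Definition equiangular_mx (R : realType) (alpha : R) (J : 'M[R]_4) : 'M[R]_4 :=
  cos alpha *: 1%:M + sin alpha *: J.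

Definition invariant_subspace (R : realType) (M : 'M[R]_4)
    (U : {vspace 'cV[R]_4}) : Prop :=
  forall x : 'cV[R]_4, x \in U -> M *m x \in U.

Definition nontrivial (R : realType) (U : {vspace 'cV[R]_4}) : Prop :=
  U <> 0%VS /\ U <> fullv.

Section Equiangular.
Variables (R : realType) (alpha : R) (a b c d : 'cV[R]_4).

Let P : 'M[R]_4 := row_mx (row_mx a b) (row_mx c d).
Let K : 'M[R]_2 := @block_mx _ 1 1 1 1 (cos alpha)%:M (- sin alpha)%:M
                                       (sin alpha)%:M (cos alpha)%:M.
Let B : 'M[R]_4 := @block_mx _ 2 2 2 2 K 0 0 K.

Lemma dot_mulmx (u v : 'cV[R]_4) (r : R) : dot u v = r -> u^T *m v = r%:M.
Proof. by move=> <-; rewrite [LHS]mx11_scalar. Qed.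

Lemma orthonormal_frame : orthonormal_basis a b c d -> P^T *m P = 1%:M.
Proof.
move=> h; have g i j := dot_mulmx (h i j).
move: (g 0 0) (g 0 1) (g 0 2%:R) (g 0 3%:R) (g 1 0) (g 1 1) (g 1 2%:R) (g 1 3%:R).
move: (g 2%:R 0) (g 2%:R 1) (g 2%:R 2%:R) (g 2%:R 3%:R).
move: (g 3%:R 0) (g 3%:R 1) (g 3%:R 2%:R) (g 3%:R 3%:R).
rewrite !(tnth_nth 0) /= => g0 g1 g2 g3 g4 g5 g6 g7 g8 g9 g10 g11 g12 g13 g14 g15.
rewrite /P (@tr_row_mx _ 4 2 2) !(@tr_row_mx _ 4 1 1).
rewrite (@mul_col_row _ 2 2 4 2 2).
rewrite !(@mul_col_row _ 1 1 4 1 1).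
rewrite g0 g1 g2 g3 g4 g5 g6 g7 g8 g9 g10 g11 g12 g13 g14 g15.
by rewrite !raddf0 !block_mx0 -!scalar_mx_block.
Qed.

Lemma frame_eqs (M : 'M[R]_4) :
  M *m P = P *m B <->
  (M *m a = cos alpha *: a + sin alpha *: b /\
   M *m b = - sin alpha *: a + cos alpha *: b) /\
  (M *m c = cos alpha *: c + sin alpha *: d /\
   M *m d = - sin alpha *: c + cos alpha *: d).
Proof.
have -> : P *m B = row_mx
   (row_mx (cos alpha *: a + sin alpha *: b) (- sin alpha *: a + cos alpha *: b))
   (row_mx (cos alpha *: c + sin alpha *: d) (- sin alpha *: c + cos alpha *: d)).
  rewrite /P /B /K (@mul_row_block _ 4 2 2 2 2) !mulmx0 addr0 add0r.
  by rewrite !(@mul_row_block _ 4 1 1 1 1) !mul_mx_scalar.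
rewrite /P (@mul_mx_row _ 4 4 2 2) !(@mul_mx_row _ 4 4 1 1); split.
  by move=> /(@eq_row_mx _ 4 2 2) [/(@eq_row_mx _ 4 1 1) [? ?] /(@eq_row_mx _ 4 1 1) [? ?]].
by move=> [[-> ->] [-> ->]].
Qed.

Lemma plane_rotation_orth : K^T *m K = 1%:M.
Proof.
rewrite /K (@tr_block_mx _ 1 1 1 1) (@mulmx_block _ 1 1 1 1 1 1).
rewrite !tr_scalar_mx -!scalar_mxM -!raddfD /=.
rewrite mulrN mulNr mulrNN (mulrC (cos _) (sin _)) !addNr.
rewrite -!expr2 (addrC (sin _ ^+ 2)) cos2Dsin2 raddf0.
by rewrite -(@scalar_mx_block _ 1 1).
Qed.

Lemma frame_rotation_orth : B^T *m B = 1%:M.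
Proof.
rewrite /B (@tr_block_mx _ 2 2 2 2) (@mulmx_block _ 2 2 2 2 2 2).
rewrite !trmx0 !mulmx0 !mul0mx !addr0 !add0r plane_rotation_orth.
by rewrite -(@scalar_mx_block _ 2 2).
Qed.

Lemma det_frame_rotation : \det B = 1.
Proof.
rewrite /B (@det_ublock _ 2 2) -{1}(det_tr K) -det_mulmx.
by rewrite plane_rotation_orth det1.
Qed.

Lemma equiangularE (M : 'M[R]_4) : orthonormal_basis a b c d ->
  equiangular alpha a b c d M <-> M = equiangular_mx alpha (Jmx a b c d).
Proof.
move=> h; set F := equiangular_mx _ _.
have PP := orthonormal_frame h.
have PPt : P *m P^T = 1%:M by apply: mulmx1C.
have dP : \det P != 0.
  by apply/eqP => d0; have /eqP := congr1 determinant PP;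
     rewrite det_mulmx d0 mulr0 det1 eq_sym oner_eq0.
have FP : F *m P = P *m B.
  have g i j := dot_mulmx (h i j).
  move: (g 0 0) (g 0 1) (g 0 2%:R) (g 0 3%:R) (g 1 0) (g 1 1) (g 1 2%:R) (g 1 3%:R).
  move: (g 2%:R 0) (g 2%:R 1) (g 2%:R 2%:R) (g 2%:R 3%:R).
  move: (g 3%:R 0) (g 3%:R 1) (g 3%:R 2%:R) (g 3%:R 3%:R).
  rewrite !(tnth_nth 0) /= => g0 g1 g2 g3 g4 g5 g6 g7 g8 g9 g10 g11 g12 g13 g14 g15.
  apply/frame_eqs; rewrite /F /equiangular_mx /Jmx.
  rewrite !mulmxDl -!scalemxAl !mul1mx !mulmxDl !mulNmx -!mulmxA.
  rewrite g0 g1 g2 g3 g4 g5 g6 g7 g8 g9 g10 g11 g12 g13 g14 g15.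
  rewrite !mul_mx_scalar !scale0r !scale1r !oppr0 ?addr0 ?add0r ?subr0 ?sub0r.
  by rewrite !scalerN !scaleNr ?(addrC (cos alpha *: b)) ?(addrC (cos alpha *: d)).
have unique : M *m P = P *m B -> M = F.
  by move=> MP; rewrite -[M]mulmx1 -PPt mulmxA MP -FP -mulmxA PPt mulmx1.
split=> [[_ _ ab cd]|->]; first by apply/unique/frame_eqs.
have [ab cd] := (frame_eqs F).1 FP; split=> //; split.
  have -> : F = P *m B *m P^T by rewrite -FP -mulmxA PPt mulmx1.
  rewrite !trmx_mul trmxK -!mulmxA (mulmxA P^T) PP mul1mx.
  by rewrite (mulmxA B^T) frame_rotation_orth mul1mx.
have /(congr1 determinant) := FP; rewrite !det_mulmx det_frame_rotation mulr1.
by rewrite -[RHS]mul1r; apply: mulIf.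
Qed.
End Equiangular.

(* Main.v *)
(* The plane span {u, J u} is J-invariant because J^2 = - I. If W is J-invariant
   and v is not in W, then W + span {v, J v} has dimension \dim W + 2, since
   J v = w + l v with w in W would give - (1 + l^2) v = (J + l I) w, which lies
   in W. Hence non-trivial J-invariant subspaces of R^4 are the planes
   span {u, J u}, and the planes through u + t v, t real, are pairwise distinct
   when v is not in span {u, J u}. As R is an affine function of J that is
   non-constant when sin alpha <> 0, R and J have the same invariant
   subspaces. *)
Require Import Defs.
From HB Require Import structures.
From mathcomp Require Import all_boot all_order all_algebra.
From mathcomp Require Import all_classical all_reals all_analysis.

Import Order.TTheory GRing.Theory Num.Theory.
Local Open Scope classical_set_scope.
Local Open Scope ring_scope.

Lemma memvZ_neq0 (K : fieldType) (vT : vectType K) (U : {vspace vT}) (k : K) (v : vT) :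
  k != 0 -> (k *: v \in U) = (v \in U).
Proof. by move=> k0; rewrite rpredZeq (negPf k0). Qed.

Lemma dim_addv_line (K : fieldType) (vT : vectType K) (W : {vspace vT}) (v : vT) :
  v \notin W -> \dim (W + <[v]>) = (\dim W).+1.
Proof.
move=> vW; rewrite dimv_disjoint_sum ?dim_vline.
  by case: eqP vW => [->|_ _]; [rewrite mem0v|rewrite addn1].
apply/eqP; rewrite -subv0; apply/subvP => x /memv_capP[xW /vlineP[k xE]].
move: xW; rewrite xE.
case: (eqVneq k 0) => [->|k0]; first by rewrite scale0r !mem0v.
by rewrite memvZ_neq0 // (negPf vW).
Qed.

Lemma Jmx_skew (R : realType) (a b c d : 'cV[R]_4) :
  (Jmx a b c d)^T = - Jmx a b c d.
Proof.
rewrite /Jmx !(linearB, linearD) /= !trmx_mul !trmxK !(opprD, opprK).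
by rewrite [a *m _ - _]addrC -!addrA [c *m _ - _]addrC.
Qed.

Lemma Jmx_sqr (R : realType) (a b c d : 'cV[R]_4) :
  orthonormal_basis a b c d -> Jmx a b c d *m Jmx a b c d = - 1%:M.
Proof.
move=> abcd; set J := Jmx a b c d.
(* J is itself the equiangular rotation of angle pi / 2. *)
have : equiangular (pi / 2) a b c d J.
  by apply/(equiangularE _ _ abcd);
     rewrite /equiangular_mx cos_pihalf sin_pihalf scale0r scale1r add0r.
(* Orthogonality gives [J^T J = I], and skew-symmetry turns [J^T] into [- J]. *)
by case=> -[JJ _] _ _ _; rewrite -JJ Jmx_skew mulNmx opprK.
Qed.

Lemma equiangular_mx_invariantE (R : realType) (t : R) (J : 'M[R]_4)
    (U : {vspace 'cV[R]_4}) : sin t != 0 ->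
  invariant_subspace (equiangular_mx t J) U <-> invariant_subspace J U.
Proof.
move=> st; have E x : equiangular_mx t J *m x = cos t *: x + sin t *: (J *m x).
  by rewrite /equiangular_mx mulmxDl -!scalemxAl mul1mx.
split=> inv x xU; last by rewrite E memvD // memvZ // inv.
by have := inv x xU; rewrite E rpredDl; [rewrite memvZ_neq0|apply: memvZ].
Qed.

(** * Complex structures on real 4-space: invariant subspaces as complex lines *)

Section ComplexStructure.
Variables (R : realType) (J : 'M[R]_4).
Hypothesis JJ : J *m J = - 1%:M.
Local Notation plane u := (<<[:: u%R; (J *m u)%R]>>%VS).
Implicit Types (u v x : 'cV[R]_4) (U W : {vspace 'cV[R]_4}).

Lemma mulmxJJ x : J *m (J *m x) = - x.
Proof. by rewrite mulmxA JJ mulNmx mul1mx. Qed.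

(** Applying [J] twice to a row eigenvector [v] gives [l^2 v = - v], hence [l^2 + 1 = 0], impossible
    for real [l]. *)
Lemma sqr_oppr1_no_eigenvalue (l : R) : ~~ eigenvalue J l.
Proof.
apply/negP => /eigenvalueP[v vJ v0].
have : (l * l + 1) *: v = 0.
  rewrite scalerDl -scalerA scale1r -vJ scalemxAl -vJ -mulmxA JJ.
  by rewrite mulmxN mulmx1 addNr.
move/eqP; rewrite scaler_eq0 (negPf v0) orbF -expr2.
by rewrite gt_eqF // ltr_wpDl ?sqr_ge0.
Qed.

Lemma mem_plane u x :
  x \in plane u <-> exists p q, x = p *: u + q *: (J *m u).
Proof.
rewrite span_cons span_seq1; split.
  by case/memv_addP => _ /vlineP[p ->] [_ /vlineP[q ->] ->]; exists p, q.
by case=> p [q ->]; rewrite memv_add ?memvZ ?memv_line.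
Qed.

Lemma plane_invariant u : invariant_subspace J (plane u).
Proof.
move=> x /mem_plane[p [q ->]]; apply/mem_plane; exists (- q), p.
by rewrite mulmxDr -!scalemxAr mulmxJJ scalerN scaleNr addrC.
Qed.

Lemma plane_sub u U :
  invariant_subspace J U -> u \in U -> (plane u <= U)%VS.
Proof.
move=> inv uU; apply/span_subvP => x; rewrite !inE.
by case/orP => /eqP -> //; apply: inv.
Qed.

Lemma dim_add_plane W v : invariant_subspace J W -> v \notin W ->
  \dim (W + plane v) = (\dim W).+2.
Proof.
move=> inv vW; rewrite span_cons span_seq1 addvA !dim_addv_line //.
apply/negP => /memv_addP[w wW [_ /vlineP[l ->] JvE]].
case/negP: vW; have : (1 + l * l) *: v \in W.
  have -> : (1 + l * l) *: v = - (J *m w + l *: w).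
    have -> : w = J *m v - l *: v by rewrite JvE addrK.
    rewrite mulmxBr mulmxJJ -scalemxAr scalerBr scalerA addrA subrK.
    by rewrite opprB opprK addrC scalerDl scale1r.
  by rewrite memvN memvD ?memvZ ?inv.
by rewrite memvZ_neq0 // gt_eqF // ltr_wpDr // -expr2 sqr_ge0.
Qed.

(** The case [W = 0] of [dim_add_plane]. *)
Lemma dim_plane u : u != 0 -> \dim (plane u) = 2%N.
Proof.
move=> u0; have := @dim_add_plane 0%VS u.
rewrite add0v dimv0 memv0 => -> // x; rewrite !memv0 => /eqP ->.
by rewrite mulmx0.
Qed.

Lemma dim_colspace : \dim {:'cV[R]_4} = 4%N.
Proof. by rewrite dimvf. Qed.

(** A vector [v] of [U] outside [plane u] would put the 4-dimensional sum [plane u + plane v] inside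
    [U], making [U] the whole space. *)
Lemma nontrivial_invariantE U u :
  nontrivial U -> invariant_subspace J U -> u \in U -> u != 0 ->
  U = plane u.
Proof.
move=> [_ Uf] inv uU u0; set W := <<_>>%VS.
have WU : (W <= U)%VS by apply: plane_sub.
apply/eqP; rewrite eqEsubv WU andbT; apply/subvP => v vU.
apply/negPn/negP => vW; apply: Uf; apply/eqP.
rewrite eqEdim subvf dim_colspace.
have dimW : \dim (W + plane v) = 4%N.
  by rewrite dim_add_plane ?dim_plane //; apply: plane_invariant.
by rewrite -[X in (X <= _)%N]dimW dimvS // subv_add WU plane_sub.
Qed.

Lemma nontrivial_invariant_dim U :
  nontrivial U -> invariant_subspace J U -> \dim U = 2%N.
Proof.
move=> ntU inv; have U0 : U != 0%VS by apply/eqP; case: ntU.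
have p0 : vpick U != 0 by rewrite vpick0.
by rewrite (nontrivial_invariantE _ _ ntU inv (memv_pick U) p0) dim_plane.
Qed.

(** If the planes for [s <> t] coincide, they contain [(s - t) v], hence [v] and then [u]; by
    dimension they equal [plane u], which excludes [v]. *)
Lemma plane_inj u v : v \notin plane u -> u != 0 ->
  injective (fun t : R => plane (u + t *: v)).
Proof.
move=> vW u0 s t /= E; apply/eqP/negPn/negP => st; case/negP: vW.
set U := plane (u + s *: v) in E.
have inv : invariant_subspace J U by apply: plane_invariant.
have sU : u + s *: v \in U by rewrite memv_span // mem_head.
have tU : u + t *: v \in U by rewrite E memv_span // mem_head.
have vU : v \in U.
  have := memvB sU tU; rewrite opprD addrACA subrr add0r -scalerBl.
  by rewrite memvZ_neq0 // subr_eq0.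
have uU : u \in U by rewrite -(addrK (s *: v) u) memvB ?memvZ.
have /eqP -> // : plane u == U.
rewrite eqEdim plane_sub // dim_plane //.
by rewrite (leq_trans (dim_span _)).
Qed.

Lemma infinite_invariant_planes :
  infinite_set [set U : {vspace 'cV[R]_4} |
    invariant_subspace J U /\ \dim U = 2%N].
Proof.
pose u : 'cV[R]_4 := const_mx 1.
have u0 : u != 0.
  by apply/eqP => /matrixP/(_ 0 0)/eqP; rewrite !mxE oner_eq0.
have [v vW] : exists v, v \notin plane u.
  apply: contrapT => /forallNP all; suff : (\dim {:'cV[R]_4} <= 2)%N.
    by rewrite dim_colspace.
  rewrite -[X in (_ <= X)%N](dim_plane _ u0); apply/dimvS/subvP => v _.
  by apply/negPn/negP/all.
pose f (n : nat) := plane (u + n%:R *: v).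
have finj : injective f.
  by move=> m n /(plane_inj _ _ vW u0)/eqP; rewrite eqr_nat => /eqP.
(* The preimage of a finite set under the injective [f] is finite, yet here it is all of [nat]. *)
move=> /(finite_preimage (f := f)) fin; apply: infinite_nat.
apply: sub_finite_set (fin _); last by move=> m n _ _ /finj.
move=> n _; split; first exact: plane_invariant.
(* Were [u + n v = 0], then [n = 0] would give [u = 0], and [n <> 0] would put [v] in [plane u]. *)
apply: dim_plane; apply: contraNneq vW => un0.
have [n0|n0] := eqVneq (n%:R : R) 0.
  by move: un0 u0; rewrite n0 scale0r addr0 => ->; rewrite eqxx.
have : n%:R *: v \in plane u.
  by rewrite -memvN -(add0r (- _)) -un0 addrK memv_span // mem_head.
by rewrite memvZ_neq0.
Qed.

End ComplexStructure.

Theorem mainTheorem3 (R : realType) (alpha : R) (a b c d : 'cV[R]_4)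
    (Rot : 'M[R]_4) (hRot : equiangular alpha a b c d Rot) :
  let J := Jmx a b c d in
  [/\ (* the displayed form of the rotation *)
      Rot = equiangular_mx alpha J,
      (* invariant subspaces of the rotation and of J *)
      sin alpha != 0 -> forall U : {vspace 'cV[R]_4},
        invariant_subspace Rot U <-> invariant_subspace J U,
      (* J is skew-symmetric, squares to - I, has no real eigenvalue, and its
         non-trivial invariant subspaces are planes *)
      [/\ J^T = - J, J *m J = - 1%:M,
          forall l : R, ~~ eigenvalue J l
        & forall U : {vspace 'cV[R]_4},
            nontrivial U -> invariant_subspace J U -> \dim U = 2%N],
      (* the invariant subspaces of the rotation *)
      [/\ forall u : 'cV[R]_4, invariant_subspace Rot <<[:: u; J *m u]>>%VS,
          sin alpha != 0 -> forall U : {vspace 'cV[R]_4},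
            nontrivial U -> invariant_subspace Rot U ->
            [/\ \dim U = 2%N,
                forall u : 'cV[R]_4, u \in U -> J *m u \in U
              & forall u : 'cV[R]_4, u \in U -> u != 0 ->
                  U = <<[:: u; J *m u]>>%VS]
        & infinite_set [set U : {vspace 'cV[R]_4} |
            invariant_subspace Rot U /\ \dim U = 2%N]]
    & (* independence of the rotation angle *)
      sin alpha != 0 -> forall beta : R, sin beta != 0 ->
        forall U : {vspace 'cV[R]_4},
        invariant_subspace (equiangular_mx beta J) U <->
        invariant_subspace Rot U].
Proof.
move=> J; have [_ abcd _ _] := hRot.
have RE : Rot = equiangular_mx alpha J by apply/(equiangularE _ _ abcd).
have JJ : J *m J = - 1%:M by apply: Jmx_sqr.
have RotJ := equiangular_mx_invariantE R alpha J.
(* This direction holds at every angle; it serves the claims on spans and on infinitely many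
   planes. *)
have JRot U : invariant_subspace J U -> invariant_subspace Rot U.
  move=> inv x xU; rewrite RE mulmxDl -!scalemxAl mul1mx.
  by rewrite memvD // memvZ // inv.
split => //.
- by rewrite RE => sa U; apply: RotJ.
- split=> //; [exact: Jmx_skew|exact: sqr_oppr1_no_eigenvalue|].
  exact: nontrivial_invariant_dim.
- split.
  + by move=> u; apply/JRot/plane_invariant.
  + move=> sa U ntU; rewrite RE => /(RotJ _ sa) inv; split=> //.
      exact: nontrivial_invariant_dim inv.
    by move=> u; apply: nontrivial_invariantE.
  + apply: sub_infinite_set (infinite_invariant_planes R J JJ).
    by move=> U [/JRot].
(* Both rotations share the invariant subspaces of [J]. *)
- move=> sa beta sb U; rewrite RE.
  by split=> /equiangular_mx_invariantE-/(_ _) inv;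
     apply/equiangular_mx_invariantE => //; apply: inv.
Qed.
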